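(* Let $\epsilon>0$, $\delta\in(0,1)$, let $p\ge2$ be an integer, and let $\mathbf{s}=(s_1,\ldots,s_r)$ be a real-valued query with finite global sensitivities $\Delta_{1,k}$ (of $s_k$) and $\Delta_p$ (of $\mathbf{s}$). For $b>0$, consider the generalized Gaussian mechanism of order $p$ with scale $b$, which given data $\mathbf{x}$ releases $\mathbf{s}^*\in\mathbb{R}^r$ drawn from the density $$f(\mathbf{s}^*\mid\mathbf{x})=\prod_{k=1}^r\frac{p}{2b\,\Gamma(p^{-1})}\exp\left\{-\left(\frac{|s_k^*-s_k(\mathbf{x})|}{b}\right)^p\right\}.$$ If $b$ satisfies $$\Pr\left(\sum_{k=1}^r\sum_{j=1}^{p-1}\binom{p}{j}|s_k^*-s_k|^{p-j}\Delta_{1,k}^j>b^p\epsilon-\Delta_p^p\right)<\delta,$$ where $s_k=s_k(\mathbf{x})$ and $\mathbf{s}^*=(s_1^*,\ldots,s_r^* )$ is drawn from the density $f(\cdot\mid\mathbf{x})$, then the mechanism satisfies $(\epsilon,\delta)$-probabilistic differential privacy.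
   Context: $d(\mathbf{x},\mathbf{x}')=1$ is a symmetric neighboring relation on data sets (they differ by one individual). $\Delta_{1,k}=\max_{d(\mathbf{x},\mathbf{x}')=1}|s_k(\mathbf{x})-s_k(\mathbf{x}')|$ and $\Delta_p=\max_{d(\mathbf{x},\mathbf{x}')=1}\left(\sum_{k=1}^r|s_k(\mathbf{x})-s_k(\mathbf{x}')|^p\right)^{1/p}$ (maxima understood as suprema). A mechanism with output density $f(\cdot\mid\mathbf{x})$ satisfies $(\epsilon,\delta)$-probabilistic differential privacy (pDP) if for all $\mathbf{x},\mathbf{x}'$ with $d(\mathbf{x},\mathbf{x}')=1$, when $\mathbf{s}^*$ is drawn from $f(\cdot\mid\mathbf{x})$, $\Pr\left(\left|\log\left(f(\mathbf{s}^*\mid\mathbf{x})/f(\mathbf{s}^*\mid\mathbf{x}')\right)\right|>\epsilon\right)\le\delta$; i.e. the probability of generating an output in the disclosure set is at most $\delta$. The distribution of $\mathbf{s}^*-\mathbf{s}(\mathbf{x})$ does not depend on $\mathbf{x}$. *)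

(* Defs.v *)
From HB Require Import structures.
From mathcomp Require Import all_boot all_order all_algebra.
From mathcomp Require Import all_classical all_reals all_analysis.

Set Implicit Arguments.
Unset Strict Implicit.
Unset Printing Implicit Defensive.

Import Order.TTheory GRing.Theory Num.Theory.
Import numFieldNormedType.Exports.

Local Open Scope classical_set_scope.
Local Open Scope ring_scope.

(* Lebesgue measure on R^n, with R^n represented by n.-tuple R. It is built by
   recursion on n, as the image of the product of the Lebesgue measures on R
   and on R^n under (x, t) |-> x :: t. *)

Section lebesgue_cons.
Local Open Scope ereal_scope.
Context {R : realType} {n : nat}.
Variable m : {sigma_finite_measure set (n.-tuple R) -> \bar R}.

Definition tuple_cons (u : R * n.-tuple R) : n.+1.-tuple R :=
  [tuple of u.1 :: u.2].

Lemma measurable_tuple_cons : measurable_fun [set: R * n.-tuple R] tuple_cons.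
Proof. exact: measurable_cons. Qed.

Definition lebesgue_cons : set (n.+1.-tuple R) -> \bar R :=
  pushforward (lebesgue_measure \x m) tuple_cons.

Let preim_measurable (A : set (n.+1.-tuple R)) :
  measurable A -> measurable (tuple_cons @^-1` A).
Proof.
by move=> mA; rewrite -[X in measurable X]setTI; exact: measurable_tuple_cons.
Qed.

Let lebesgue_cons0 : lebesgue_cons set0 = 0.
Proof. by rewrite /lebesgue_cons /pushforward preimage_set0 measure0. Qed.

Let lebesgue_cons_ge0 A : 0 <= lebesgue_cons A.
Proof. exact: (measure_ge0 (lebesgue_measure \x m)). Qed.

Let lebesgue_cons_sigma_additive : semi_sigma_additive lebesgue_cons.
Proof.
move=> F mF tF mUF; rewrite /lebesgue_cons /pushforward preimage_bigcup.
apply: measure_semi_sigma_additive.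
- by move=> k; exact: preim_measurable.
- apply/trivIsetP => /= i j _ _ ij; rewrite -preimage_setI.
  by move/trivIsetP : tF => /(_ _ _ _ _ ij) ->//; rewrite preimage_set0.
- by rewrite -preimage_bigcup; exact: preim_measurable.
Qed.

HB.instance Definition _ := isMeasure.Build _ _ _ lebesgue_cons
  lebesgue_cons0 lebesgue_cons_ge0 lebesgue_cons_sigma_additive.

Lemma lebesgue_consE (A : set R) (B : set (n.-tuple R)) :
    measurable A -> measurable B ->
  lebesgue_cons [set t | A (thead t) /\ B [tuple of behead t]] =
  lebesgue_measure A * m B.
Proof.
move=> mA mB; rewrite -product_measure1E// /lebesgue_cons /pushforward.
have cbe (u : R * n.-tuple R) : [tuple of behead (tuple_cons u)] = u.2.
  exact/val_inj.
by congr (product_measure1 _ _ _); apply/seteqP; split=> u /=;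
  rewrite cbe theadE.
Qed.

Let lebesgue_cons_sigma_finite : sigma_finite setT lebesgue_cons.
Proof.
have /sigma_finiteP[F [TF ndF Foo]] := sigma_finiteT (@lebesgue_measure R).
have /sigma_finiteP[G [TG ndG Goo]] := sigma_finiteT m.
exists (fun k => [set t | F k (thead t) /\ G k [tuple of behead t]]).
  apply/esym; rewrite -subTset => t _.
  have [i _ Fi] : (\bigcup_i F i) (thead t) by rewrite -TF.
  have [j _ Gj] : (\bigcup_i G i) [tuple of behead t] by rewrite -TG.
  exists (maxn i j) => //; split.
  - by move: Fi; exact/subsetPset/ndF/leq_maxl.
  - by move: Gj; exact/subsetPset/ndG/leq_maxr.
move=> k; have [mF Fk] := Foo k; have [mG Gk] := Goo k; split.
  apply: measurableI.
    rewrite -[X in measurable X]setTI.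
    exact: (@measurable_tnth _ _ n.+1 ord0).
  rewrite -[X in measurable X]setTI.
  exact: measurable_behead.
by rewrite lebesgue_consE// lte_mul_pinfty// ge0_fin_numE.
Qed.

HB.instance Definition _ := Measure_isSigmaFinite.Build _ _ _ lebesgue_cons
  lebesgue_cons_sigma_finite.

End lebesgue_cons.

Fixpoint lebesgue_tuple {R : realType} n :
    {sigma_finite_measure set (n.-tuple R) -> \bar R} :=
  match n with
  | 0 => \d_[tuple]
  | n'.+1 => lebesgue_cons (lebesgue_tuple n')
  end.

Lemma lebesgue_tuple_box (R : realType) n (A : 'I_n -> set R) :
    (forall i, measurable (A i)) ->
  (lebesgue_tuple n [set t | forall i, A i (tnth t i)] =
   \prod_(i < n) lebesgue_measure (A i))%E.
Proof.
elim: n A => [|n IHn] A mA.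
  by rewrite big_ord0 /= diracE mem_set// => -[].
pose B := [set t : n.-tuple R | forall i, A (lift ord0 i) (tnth t i)].
have mB : measurable B.
  rewrite (_ : B = \bigcap_(i in [set: 'I_n])
      ((@tnth _ R)^~ i @^-1` A (lift ord0 i))); last first.
    by apply/seteqP; split=> t /= Bt i; [move=> _|]; exact: Bt.
  apply: fin_bigcap_measurable => // i _; rewrite -[X in measurable X]setTI.
  exact: measurable_tnth.
rewrite big_ord_recl -IHn// -lebesgue_consE//.
congr (lebesgue_cons _ _); apply/seteqP; split=> t /=.
  move=> At; split; first exact: At.
  by move=> i; rewrite tnth_behead -(_ : lift ord0 i = inord i.+1)//;
    apply: val_inj; rewrite /= inordK// ltnS.
move=> [At Bt] i; case: (unliftP ord0 i) => [j ->|->//].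
have := Bt j; rewrite tnth_behead.
by rewrite (_ : inord j.+1 = lift ord0 j)//; apply: val_inj;
  rewrite /= inordK// ltnS.
Qed.

Definition density_prob {R : realType} {r} (f : r.-tuple R -> R)
    (A : set (r.-tuple R)) : \bar R :=
  (\int[lebesgue_tuple r]_(t in A) (f t)%:E)%E.

Section differential_privacy.
Context {R : realType} {X : Type} (nb : X -> X -> Prop).

(* Without neighbouring data sets the supremum below is -oo, whose [fine] part
   is the conventional value 0. *)
Definition sensitivity (g : X -> X -> R) : \bar R :=
  ereal_sup [set y | exists x x', nb x x' /\ y = (g x x')%:E].

(* Delta_{1,k} *)
Definition sensitivity1 {r} (s : X -> r.-tuple R) (k : 'I_r) : \bar R :=
  sensitivity (fun x x' => `|tnth (s x) k - tnth (s x') k|).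

(* Delta_p *)
Definition sensitivity_lp (p : nat) {r} (s : X -> r.-tuple R) : \bar R :=
  sensitivity (fun x x' =>
    (\sum_(k < r) `|tnth (s x) k - tnth (s x') k| ^+ p) `^ p%:R^-1).

(* The logarithm and the quotient are those of the extended reals, so that the
   disclosure set contains the outputs at which only one of the two densities
   vanishes. *)
Definition disclosure_set {r} (f : X -> r.-tuple R -> R) (eps : R) (x x' : X) :
    set (r.-tuple R) :=
  [set t | (eps%:E < `|lne ((f x t)%:E / (f x' t)%:E)|)%E].

Definition probabilistic_dp {r} (f : X -> r.-tuple R -> R) (eps delta : R) :=
  forall x x', nb x x' ->
    (density_prob (f x) (disclosure_set f eps x x') <= delta%:E)%E.

End differential_privacy.

Section generalized_gaussian.
Context {R : realType}.

(* Euler's Gamma function, for a > 0 *)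
Definition Gamma (a : R) : R :=
  \int[lebesgue_measure]_(u in `]0, +oo[) (u `^ (a - 1) * expR (- u)).

Definition ggm_density (p : nat) (b : R) {X : Type} {r}
    (s : X -> r.-tuple R) (x : X) (t : r.-tuple R) : R :=
  \prod_(k < r) (p%:R / (2 * b * Gamma p%:R^-1) *
    expR (- (`|tnth t k - tnth (s x) k| / b) ^+ p)).

End generalized_gaussian.

(* Main.v *)
(* On the log-scale the ratio of the two densities at t is
     b^-p * sum_k (|t_k - s_k(x')|^p - |t_k - s_k(x)|^p).
   With a_k = |t_k - s_k(x)| and d_k = |s_k(x) - s_k(x')|, each summand is at
   most (a_k + d_k)^p - a_k^p in absolute value. Expanding by the binomial
   theorem and bounding d_k by Delta_{1,k} and sum_k d_k^p by Delta_p^p puts the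
   disclosure set inside the event of the hypothesis. The hypothesis concerns
   a single data set; translation invariance of the Lebesgue measure transfers
   it to all the others. *)

From HB Require Import structures.
Require Import Defs.
From mathcomp Require Import all_boot all_order all_algebra.
From mathcomp Require Import all_classical all_reals all_analysis.
From mathcomp Require Import measurable_realfun ring lra.

Set Implicit Arguments.
Unset Strict Implicit.
Unset Printing Implicit Defensive.

Import Order.TTheory GRing.Theory Num.Theory.
Import numFieldNormedType.Exports.

Local Open Scope classical_set_scope.
Local Open Scope ring_scope.


(** * Elementary inequalities for powers *)

(** Increments of the p-th power grow to the right. If [a <= a'], then [a' <= a + d] and
    monotonicity suffices. Otherwise both differences factor as a step times a sum of mixed powers:
    the steps are [a - a' <= d] and [d], and the sums compare term by term because
    [a' <= a <= a + d]. *)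
Lemma ler_dist_expr (R : realFieldType) (p : nat) (a a' d : R) :
  0 <= a -> 0 <= a' -> `|a' - a| <= d ->
  `|a' ^+ p - a ^+ p| <= (a + d) ^+ p - a ^+ p.
Proof.
move=> a0 a'0; rewrite ler_norml lerBlDr => /andP[da ad].
have d0 : 0 <= d by lra.
have a'D : a' <= a + d by rewrite addrC.
have [aa'|/ltW a'a] := leP a a'.
  rewrite ger0_norm ?subr_ge0 ?lerXn2r ?nnegrE// ?lerB ?lerXn2r ?nnegrE//.
  by rewrite addr_ge0.
rewrite distrC ger0_norm ?subr_ge0 ?lerXn2r ?nnegrE// !subrXX.
rewrite addrAC subrr add0r ler_pM ?subr_ge0//.
- by rewrite sumr_ge0// => i _; rewrite mulr_ge0 ?exprn_ge0.
- by lra.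
- apply: ler_sum => i _; rewrite ler_pM ?exprn_ge0 ?lerXn2r ?nnegrE//.
  + by rewrite addr_ge0.
  + by rewrite lerDl.
Qed.

(** The term j = 0 cancels [a ^+ p]. The term j = p is kept apart because it will be bounded through
    Delta_p, the others through Delta_{1,k}. *)
Lemma exprD_sub_binomial (R : comPzRingType) (p : nat) (a d : R) : (0 < p)%N ->
  (a + d) ^+ p - a ^+ p =
  \sum_(1 <= j < p) 'C(p, j)%:R * a ^+ (p - j) * d ^+ j + d ^+ p.
Proof.
move=> p0; rewrite exprDn.
rewrite -(big_mkord xpredT (fun j => a ^+ (p - j) * d ^+ j *+ 'C(p, j))).
rewrite big_nat_recr//= big_ltn// subn0 expr0 mulr1 bin0 mulr1n.
rewrite subnn expr0 mul1r binn mulr1n [a ^+ p + _]addrC.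
rewrite [_ + a ^+ p + _]addrAC addrK; congr (_ + _).
by apply: eq_bigr => j _; rewrite -mulr_natl mulrA.
Qed.

(** * Translation invariance of the Lebesgue measure on tuples *)

Section translation.
Context {R : realType}.
Local Open Scope ereal_scope.

(** The Lebesgue measure is determined by its values on half-open intervals, and a shift preserves
    their lengths. *)
Lemma lebesgue_measureD (a : R) (A : set R) : measurable A ->
  pushforward lebesgue_measure ((fun u => (u + a)%R) : _ -> measurableTypeR R) A
  = lebesgue_measure A.
Proof.
move=> mA.
pose f (u : measurableTypeR R) : measurableTypeR R := (u + a)%R.
have mf : measurable_fun setT f by exact: measurable_funD.
pose mf_mixin := isMeasurableFun.Build _ _ _ _ _ mf.
pose mf_pack : {mfun _ >-> _} := HB.pack f mf_mixin.
apply/esym.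
apply: (@lebesgue_measure_unique _ (pushforward lebesgue_measure mf_pack)) => //.
move=> _ [[x y]] _ <- /=.
rewrite /pushforward (_ : _ @^-1` _ = `]x - a, y - a]%classic)%R.
  rewrite !lebesgue_measure_itv/= !lte_fin ltrD2r -!EFinB.
  by case: ifP => // _; congr EFin; ring.
by apply/seteqP; split=> u /=; rewrite !in_itv/= ltrBlDr lerBrDr.
Qed.

Lemma ge0_integral_translation (a : R) (F : R -> \bar R) :
  measurable_fun setT F -> (forall u, 0 <= F u) ->
  \int[lebesgue_measure]_u F (u + a)%R = \int[lebesgue_measure]_u F u.
Proof.
move=> mF F0.
pose f (u : measurableTypeR R) : measurableTypeR R := (u + a)%R.
have mf : measurable_fun setT f by exact: measurable_funD.
have := ge0_integral_pushforward mf lebesgue_measure measurableT mF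
  (fun u _ => F0 u).
rewrite preimage_setT => <-.
by apply: eq_measure_integral => //= A mA _; exact: lebesgue_measureD.
Qed.

(** Change of variables along [tuple_cons], followed by Tonelli. *)
Lemma ge0_integral_lebesgue_cons n
    (m : {sigma_finite_measure set (n.-tuple R) -> \bar R})
    (F : n.+1.-tuple R -> \bar R) :
  measurable_fun setT F -> (forall t, 0 <= F t) ->
  \int[lebesgue_cons m]_t F t =
  \int[lebesgue_measure]_u \int[m]_t F (tuple_cons (u, t)).
Proof.
move=> mF F0.
pose c : measurableTypeR R * n.-tuple R -> n.+1.-tuple R := tuple_cons.
have mc : measurable_fun setT c by exact: measurable_tuple_cons.
have := ge0_integral_pushforward mc (lebesgue_measure \x m) measurableT mF
  (fun u _ => F0 u).
rewrite preimage_setT => ->.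
rewrite (fubini_tonelli1 (F \o c))// => [|u]; last exact: F0.
exact: measurableT_comp.
Qed.

Definition tuple_add n (v t : n.-tuple R) : n.-tuple R :=
  [tuple (tnth t i + tnth v i)%R | i < n].

Lemma measurable_tuple_add n (v : n.-tuple R) :
  measurable_fun setT (tuple_add v).
Proof.
apply/measurable_fun_tnthP => i.
rewrite (_ : _ \o _ = (fun t => tnth t i + tnth v i)%R).
  by apply: measurable_funD => //; exact: measurable_tnth.
by apply/funext => t /=; rewrite tnth_mktuple.
Qed.

(** Induction on the dimension: the inner integral absorbs the tail of [v] by the induction
    hypothesis, the outer one absorbs its head by the one-dimensional case. *)
Lemma ge0_integral_tuple_translation n (v : n.-tuple R)
    (F : n.-tuple R -> \bar R) :
  measurable_fun setT F -> (forall t, 0 <= F t) ->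
  \int[lebesgue_tuple n]_t F (tuple_add v t) = \int[lebesgue_tuple n]_t F t.
Proof.
elim: n v F => [|n IHn] v F mF F0.
  by apply: eq_integral => t _; congr F; rewrite tuple0 [RHS]tuple0.
pose w := [tuple of behead v].
have consE u t : tuple_add v (tuple_cons (u, t)) =
    tuple_cons ((u + thead v)%R, tuple_add w t).
  apply: eq_from_tnth => i; rewrite tnth_mktuple.
  case: (unliftP ord0 i) => [j ->|->]; last by rewrite /tuple_cons !tnth0.
  rewrite /tuple_cons !tnthS tnth_mktuple tnth_behead; congr (_ + tnth v _)%R.
  by apply: val_inj; rewrite /= inordK// ltnS.
rewrite /= !ge0_integral_lebesgue_cons//; last first.
  by apply: measurableT_comp => //; exact: measurable_tuple_add.
have mcons : measurable_fun setT (F \o tuple_cons).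
  by apply: measurableT_comp => //; exact: measurable_tuple_cons.
transitivity (\int[lebesgue_measure]_u
    \int[lebesgue_tuple n]_t F (tuple_cons ((u + thead v)%R, t))).
  apply: eq_integral => u _; under eq_integral do rewrite consE.
  apply: (IHn w (fun t => F (tuple_cons ((u + thead v)%R, t)))) => //.
  exact: measurable_fun_pair2 mcons.
apply: (ge0_integral_translation _
  (F := fun u => \int[lebesgue_tuple n]_t F (tuple_cons (u, t)))) => //.
- pose c : measurableTypeR R * n.-tuple R -> n.+1.-tuple R := tuple_cons.
  apply: (measurable_fun_fubini_tonelli_F (m2 := lebesgue_tuple n) (F \o c)) => //.
  by move=> u; exact: F0.
- by move=> u; apply: integral_ge0 => t _; exact: F0.
Qed.

(** Once the event is moved into the integrand as a restriction, this is invariance of an integral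
    over the whole space. It carries probabilities from one data set to another, whose densities are
    translates of each other. *)
Lemma density_prob_translation n (v : n.-tuple R) (f : n.-tuple R -> R)
    (A : set (n.-tuple R)) :
  measurable A -> measurable_fun setT f -> (forall t, 0 <= f t)%R ->
  density_prob (f \o tuple_add v) (tuple_add v @^-1` A) = density_prob f A.
Proof.
move=> mA mf f0; rewrite /density_prob integral_mkcond [RHS]integral_mkcond.
rewrite -[RHS](ge0_integral_tuple_translation v).
- by apply: eq_integral => t _; rewrite !patchE /=; congr (if _ then _ else _);
    apply/idP/idP; rewrite !inE.
- apply/(measurable_restrictT _ mA)/measurable_EFinP.
  exact: measurable_funS mf.
- by move=> t; apply: erestrict_ge0 => u _; rewrite lee_fin.
Qed.

End translation.

(** * Sensitivity bounds, measurable events and the sign of Gamma *)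

(** The neighbouring pair itself puts a real number below the supremum, which excludes -oo; so
    [fine] loses nothing here. *)
Lemma le_fine_sensitivity (R : realType) (X : Type) (nb : X -> X -> Prop)
    (g : X -> X -> R) (x x' : X) :
  (sensitivity nb g < +oo)%E -> nb x x' -> g x x' <= fine (sensitivity nb g).
Proof.
move=> gy xx'; have gxx' : ((g x x')%:E <= sensitivity nb g)%E.
  by apply: ereal_sup_ubound; exists x, x'.
by rewrite -lee_fin fineK// fin_numElt gy (lt_le_trans _ gxx')// ltNyr.
Qed.

Lemma measurable_set_ltr d (T : measurableType d) (R : realType) (f g : T -> R) :
  measurable_fun setT f -> measurable_fun setT g ->
  measurable [set t | f t < g t].
Proof.
move=> mf mg; rewrite -[X in measurable X]setTI.
exact: (measurable_fun_ltr mf mg measurableT (Y := [set true])).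
Qed.

Lemma Gamma_ge0 (R : realType) (a : R) : 0 <= Gamma a.
Proof.
by apply: Rintegral_ge0 => u _; rewrite mulr_ge0 ?powR_ge0 ?expR_ge0.
Qed.

(** * The generalized Gaussian density and its log-ratio *)

Section generalized_gaussian_mechanism.
Context {R : realType} {X : Type} {r : nat}.
Variables (p : nat) (b : R) (s : X -> r.-tuple R).

Definition ggm_norm : R := p%:R / (2 * b * Gamma p%:R^-1).

Definition ggm_exponent (x : X) (t : r.-tuple R) : R :=
  \sum_(k < r) (`|tnth t k - tnth (s x) k| / b) ^+ p.

Lemma ggm_densityE x t :
  ggm_density p b s x t = ggm_norm ^+ r * expR (- ggm_exponent x t).
Proof.
rewrite /ggm_density big_split/= prodr_const card_ord; congr (_ * _).
by rewrite -expR_sum sumrN.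
Qed.

Lemma ggm_norm_ge0 : 0 < b -> 0 <= ggm_norm.
Proof. by move=> b0; rewrite divr_ge0// !mulr_ge0 ?Gamma_ge0// ltW. Qed.

Lemma ggm_density_ge0 x t : 0 < b -> 0 <= ggm_density p b s x t.
Proof.
by move=> b0; rewrite ggm_densityE mulr_ge0 ?expR_ge0 ?exprn_ge0 ?ggm_norm_ge0.
Qed.

Lemma measurable_dist_tnth (c : R) k :
  measurable_fun setT (fun t : r.-tuple R => `|tnth t k - c|).
Proof.
apply: measurableT_comp => //; apply: measurable_funB => //.
exact: measurable_tnth.
Qed.

Lemma measurable_ggm_exponent x : measurable_fun setT (ggm_exponent x).
Proof.
apply: measurable_sum => k; apply: measurable_funX; apply: measurable_funM => //.
exact: measurable_dist_tnth.
Qed.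

Lemma measurable_ggm_density x : measurable_fun setT (ggm_density p b s x).
Proof.
rewrite (_ : ggm_density p b s x =
    fun t => ggm_norm ^+ r * expR (- ggm_exponent x t)).
  apply: measurable_funM => //; apply: measurableT_comp => //.
  by apply: measurableT_comp => //; exact: measurable_ggm_exponent.
by apply/funext => t; exact: ggm_densityE.
Qed.

(** The normalising constant is the same for both data sets and cancels, so the log-ratio is a
    difference of exponents. *)
Lemma disclosure_set_ggm (eps : R) x x' : 0 < b -> ggm_norm ^+ r != 0 ->
  disclosure_set (ggm_density p b s) eps x x' =
  [set t | eps < `|ggm_exponent x' t - ggm_exponent x t|].
Proof.
move=> b0 c0; apply/seteqP.
suff E t : lne ((ggm_density p b s x t)%:E / (ggm_density p b s x' t)%:E)%E =
    (ggm_exponent x' t - ggm_exponent x t)%:E.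
  by split=> t; rewrite /disclosure_set/= E /= lte_fin.
(* The extended inverse treats 0 separately; the density at [x'] is a nonzero constant times an
   exponential. *)
rewrite !ggm_densityE inver ifF; last first.
  by rewrite mulf_eq0 (negbTE c0) gt_eqF ?expR_gt0.
rewrite -EFinM -mulf_div divff// mul1r -expRN opprK -expRD addrC.
by rewrite lne_EFin ?expR_gt0// expRK.
Qed.

Variable nb : X -> X -> Prop.

(** The random variable whose upper tail the hypothesis bounds. It depends on [x] and [t] only
    through the deviations of [t] from [s x]. *)
Definition ggm_tail_sum (x : X) (t : r.-tuple R) : R :=
  \sum_(k < r) \sum_(1 <= j < p)
    'C(p, j)%:R * `|tnth t k - tnth (s x) k| ^+ (p - j) *
    fine (sensitivity1 nb s k) ^+ j.

Lemma measurable_ggm_tail_sum x : measurable_fun setT (ggm_tail_sum x).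
Proof.
apply: measurable_sum => k; apply: measurable_sum => j.
apply: measurable_funM => //; apply: measurable_funM => //.
apply: measurable_funX; exact: measurable_dist_tnth.
Qed.

Lemma ggm_exponent_dist x x' t : 0 < b -> (0 < p)%N -> nb x x' ->
  (forall k, (sensitivity1 nb s k < +oo)%E) ->
  (sensitivity_lp nb p s < +oo)%E ->
  b ^+ p * `|ggm_exponent x' t - ggm_exponent x t| <=
  ggm_tail_sum x t + fine (sensitivity_lp nb p s) ^+ p.
Proof.
move=> b0 p0 xx' fin1 finp.
pose a k := `|tnth t k - tnth (s x) k|.
pose a' k := `|tnth t k - tnth (s x') k|.
pose d k := `|tnth (s x) k - tnth (s x') k|.
have dD k : d k <= fine (sensitivity1 nb s k).
  exact: (le_fine_sensitivity (fin1 k) xx').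
have dDp : \sum_(k < r) d k ^+ p <= fine (sensitivity_lp nb p s) ^+ p.
  have sd0 : 0 <= \sum_(k < r) d k ^+ p.
    by apply: sumr_ge0 => k _; exact/exprn_ge0/normr_ge0.
  have := le_fine_sensitivity finp xx'; rewrite -/(sensitivity_lp nb p s) => h.
  (* Delta_p bounds the p-th root of the sum; raising to the power p undoes the root. *)
  apply: (@le_trans _ _ (((\sum_(k < r) d k ^+ p) `^ p%:R^-1) ^+ p)).
    by rewrite -powR_mulrn ?powR_ge0// -powRrM mulVf ?powRr1// pnatr_eq0 -lt0n.
  by rewrite lerXn2r ?nnegrE ?powR_ge0// (le_trans _ h) ?powR_ge0.
(* The factor [b ^+ p] clears the scale from both exponents. *)
have -> : b ^+ p * `|ggm_exponent x' t - ggm_exponent x t| =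
    `|\sum_(k < r) (a' k ^+ p - a k ^+ p)|.
  rewrite -[X in X * _]ger0_norm ?exprn_ge0 ?ltW// -normrM mulrBr.
  rewrite /ggm_exponent !mulr_sumr -sumrB; congr `|_|; apply: eq_bigr => k _.
  by rewrite -!exprMn ![b * _]mulrC !divfK ?gt_eqF.
apply: (le_trans (ler_norm_sum _ _ _)).
apply: (@le_trans _ _ (\sum_(k < r) ((a k + d k) ^+ p - a k ^+ p))).
  apply: ler_sum => k _; apply: ler_dist_expr; [exact: normr_ge0..|].
  (* Writing [d k] as a difference of deviations from [t] makes the bound on [a' k - a k] the
     reverse triangle inequality. *)
  have -> : d k = `|(tnth t k - tnth (s x') k) - (tnth t k - tnth (s x) k)|.
    by rewrite /d; congr `|_|; ring.
  exact: ler_dist_dist.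
under eq_bigr do rewrite exprD_sub_binomial//.
(* The pure powers [d k ^+ p] are bounded jointly by [dDp], the mixed terms coordinate by coordinate
   by [dD]. *)
rewrite big_split/= lerD// ler_sum// => k _; apply: ler_sum => j _.
have d0 : 0 <= d k by exact: normr_ge0.
apply: ler_wpM2l; first by rewrite mulr_ge0// exprn_ge0// normr_ge0.
by rewrite lerXn2r ?nnegrE ?dD// (le_trans d0).
Qed.

End generalized_gaussian_mechanism.

(** * Transfer of the tail bound between data sets, and privacy *)

Theorem corollary7 (R : realType) (X : Type) (nb : X -> X -> Prop)
  (nb_sym : forall x x', nb x x' -> nb x' x)
  (r p : nat) (s : X -> r.-tuple R) (eps delta b : R)
  (eps_gt0 : 0 < eps) (delta_gt0 : 0 < delta) (delta_lt1 : delta < 1)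
  (p_ge2 : (2 <= p)%N)
  (fin_Delta1 : forall k, (sensitivity1 nb s k < +oo)%E)
  (fin_Deltap : (sensitivity_lp nb p s < +oo)%E)
  (b_gt0 : 0 < b) (x : X) :
  (density_prob (ggm_density p b s x)
     [set t | (b ^+ p * eps - fine (sensitivity_lp nb p s) ^+ p <
        \sum_(k < r) \sum_(1 <= j < p)
          'C(p, j)%:R * `|tnth t k - tnth (s x) k| ^+ (p - j) *
          fine (sensitivity1 nb s k) ^+ j)%R]
   < delta%:E)%E ->
  probabilistic_dp nb (ggm_density p b s) eps delta.
Proof.
rewrite -[X in density_prob _ X]/([set t | _ < ggm_tail_sum p s nb x t]) => hx.
move=> y y' yy'.
pose tail z := [set t | b ^+ p * eps - fine (sensitivity_lp nb p s) ^+ p <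
  ggm_tail_sum p s nb z t].
have mtail z : measurable (tail z).
  by apply: measurable_set_ltr => //; exact: measurable_ggm_tail_sum.
have f0 z t : 0 <= ggm_density p b s z t by exact: ggm_density_ge0.
have mf z : measurable_fun setT (ggm_density p b s z).
  exact: measurable_ggm_density.
have [c0|c0] := eqVneq (@ggm_norm R p b ^+ r) 0.
  (* The density is then identically zero, which spares proving Gamma > 0. *)
  rewrite /density_prob integral0_eq ?lee_fin ?ltW// => t _.
  by rewrite ggm_densityE c0 mul0r.
(* The shift by [s y - s x] preserves deviations from the query value, hence takes the density and
   tail event of [x] to those of [y]. *)
pose v := [tuple tnth (s y) k - tnth (s x) k | k < r].
have shiftE t k : tnth (tuple_add v t) k - tnth (s y) k =
    tnth t k - tnth (s x) k.
  by rewrite !tnth_mktuple; ring.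
have hy : (density_prob (ggm_density p b s y) (tail y) < delta%:E)%E.
  rewrite -(density_prob_translation v)//.
  rewrite (_ : _ \o _ = ggm_density p b s x); last first.
    by apply/funext => t /=; apply: eq_bigr => k _; rewrite shiftE.
  rewrite (_ : _ @^-1` _ = tail x)//; apply/funext => t.
  rewrite /tail/preimage/ggm_tail_sum/=.
  by under eq_bigr do rewrite shiftE.
(* It remains to include the disclosure set in the tail event at [y] and integrate the nonnegative
   density over both. *)
apply: le_trans (ltW hy); rewrite disclosure_set_ggm//.
apply: ge0_subset_integral => //.
- apply: measurable_set_ltr => //; apply: measurableT_comp => //.
  by apply: measurable_funB; exact: measurable_ggm_exponent.
- by apply/measurable_EFinP; exact: measurable_funS (mf y).
- by move=> t _; rewrite lee_fin.
- move=> t /= epst; rewrite /tail/= ltrBlDr.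
  apply: lt_le_trans (ggm_exponent_dist t b_gt0 _ yy' fin_Delta1 fin_Deltap).
    by rewrite ltr_pM2l ?exprn_gt0.
  exact: ltnW.
Qed.
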